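(* Let $F$ be a field, let $g\in F[X]$ and let $A\in M_n(F)$ have minimal polynomial $f$. Let $P$ be the set of minimal polynomials of $g$ modulo the monic irreducible factors of $f$. Then: (1) $g(A)$ is semisimple if and only if $\gcd(p(g(X)),f)=\gcd(p^2(g(X)),f)$ for all $p\in P$. (2) $g(A)$ is cyclic if and only if $A$ is cyclic and $\deg\gcd(p(g(X)),f)=\deg p$ for all $p\in P$. (3) All eigenvalues of $g(A)$ are in $F$ if and only if $P=\{X-a_1,\dots,X-a_m\}$ for some $a_1,\dots,a_m\in F$, in which case these are the eigenvalues of $g(A)$, and $g(A)$ is diagonalizable if and only if $\gcd(g-a_i,f)=\gcd((g-a_i)^2,f)$ for all $1\le i\le m$.
   Context: For a monic irreducible $r\in F[X]$, the minimal polynomial of $g$ modulo $r$ is the monic generator of the ideal of all $y\in F[X]$ such that $r$ divides $y(g(X))$. Here $p^2(g(X))=(p(g(X)))^2$, and $\gcd$ denotes the monic greatest common divisor, with $\gcd(0,f)=f$. A matrix is semisimple if its minimal polynomial is square free; it is cyclic if its minimal and characteristic polynomials coincide (equivalently, it is similar to a companion matrix). *)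

(* Defs.v *)
From HB Require Import structures.
From mathcomp Require Import all_boot all_order all_algebra.

Set Implicit Arguments.
Unset Strict Implicit.
Unset Printing Implicit Defensive.

Import GRing.Theory.
Local Open Scope ring_scope.

Section Definitions.

Variable F : fieldType.
Implicit Types (f g p q r y : {poly F}).

(* [gcdp] is only defined up to a nonzero scalar. *)
Definition monic_gcd p q : {poly F} :=
  (lead_coef (gcdp p q))^-1 *: gcdp p q.

Definition degree p : nat := (size p).-1.

Definition square_free p : Prop :=
  forall q, q ^+ 2 %| p -> size q = 1%N.

(* [p] is the monic generator of the ideal of all [y] such that [r] divides
   [y(g(X))]; recall that [y \Po g] is [y(g(X))]. *)
Definition is_minpoly_mod g r p : Prop :=
  p \is monic /\ (forall y, (r %| y \Po g) = (p %| y)).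

Definition minpolys_mod g f p : Prop :=
  exists r, [/\ r \is monic, irreducible_poly r, r %| f & is_minpoly_mod g r p].

Definition semisimple n (B : 'M[F]_n.+1) : Prop := square_free (mxminpoly B).

Definition is_cyclic_mx n (B : 'M[F]_n.+1) : Prop := mxminpoly B = char_poly B.

(* The eigenvalues of [B] are those in arbitrary field extensions of [F]. *)
Definition all_eigenvalues_in_base n (B : 'M[F]_n) : Prop :=
  forall (L : fieldType) (iota : {rmorphism F -> L}) (a : L),
    eigenvalue (map_mx iota B) a -> exists b : F, a = iota b.

Lemma is_minpoly_mod_uniq g r p q :
  is_minpoly_mod g r p -> is_minpoly_mod g r q -> p = q.
Proof.
move=> [mp hp] [mq hq]; apply/eqP; rewrite -eqp_monic //.
by apply/andP; split; [rewrite -hp hq | rewrite -hq hp]; exact: dvdpp.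
Qed.

Lemma is_minpoly_mod_exists g r :
  r \is monic -> irreducible_poly r -> exists p, is_minpoly_mod g r p.
Proof.
move=> mr [sr irr].
have [n [C rE]] : exists n, exists C : 'M[F]_n.+1, r = char_poly C.
  have := companionmxK mr; move: (companionmx r).
  case: (size r) sr => [|[|n]] //= _ C CE.
  by exists n, C.
have eq_r : mxminpoly C %= r.
  apply: irr; last by rewrite rE mxminpoly_dvd_char.
  by rewrite size_mxminpoly eqSS -lt0n mxminpoly_nonconstant.
exists (mxminpoly (horner_mx C g)); split=> [|y]; first exact: mxminpoly_monic.
rewrite -(eqp_dvdl _ eq_r) !dvd_mxminpoly; congr (_ == _).
elim/poly_ind: y => [|y c IHy]; first by rewrite comp_poly0 !rmorph0.
by rewrite comp_polyD comp_polyM comp_polyX comp_polyC !rmorphD !rmorphM /=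
  IHy !horner_mx_C horner_mx_X.
Qed.

End Definitions.

(* Main.v *)
Require Import Defs.
From HB Require Import structures.
From mathcomp Require Import all_boot all_order all_algebra.
From mathcomp Require Import all_field ring.
From Stdlib Require Import Classical.

(** Write [B = g(A)] and let [h] be the minimal polynomial of [B].  Since
    [y(B) = (y o g)(A)], one has [f | y o g] iff [h | y] ([dvd_mxminpoly_comp]).
    The whole argument rests on two consequences of this equivalence, valid for
    any nonzero [f], [h] satisfying it.

    First, the set [P] consists exactly of the monic irreducible factors of [h]
    ([minpolys_modP]).  If [r | f] is irreducible then the ideal of the [y]
    with [r | y o g] is prime and contains [h]; conversely, if [q | h] is
    irreducible then [q o g] and [f] are not coprime (otherwise a proper divisor
    of [h] would already lie in the ideal generated by [h]), so some
    irreducible [r | f] divides [q o g], and its minimal polynomial divides [q],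
    hence equals [q].

    Second, for [p] irreducible dividing [h], [p^2] does not divide [h] iff
    [gcd(p o g, f)] and [gcd((p o g)^2, f)] agree ([gcd_compP]), by Bezout.
    This gives (1).

    For (2), if [B] is cyclic then [deg h] is the size of [A], hence so is
    [deg f], because [F[B]] is contained in [F[A]]; so one may assume [A] cyclic, and must
    compare [deg f] with [deg h].  Submultiplicativity of [gcd(_, f)] and
    induction over the irreducible factors of [h] show that
    [deg gcd(p o g, f) <= deg p] for all [p] in [P] implies [deg f <= deg h]
    ([leq_size_gcd_comp]).  Conversely, if [deg h = deg f], then [F[A] = F[B]],
    so that every polynomial is congruent modulo [f] to a polynomial in [g];
    counting dimensions modulo [gcd(y o g, f)] gives
    [deg gcd(y o g, f) <= deg y] for all [y <> 0], and applying this to the two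
    factors of [h = p k] gives equality ([size_gcd_comp]).

    For (3), all eigenvalues of [B] lie in [F] iff every irreducible factor of
    [h] is linear, since an irreducible polynomial has a root in some extension
    field; and [B] is diagonalizable iff moreover [h] is square free, which is
    reduced to (1). *)

Set Implicit Arguments.
Unset Strict Implicit.
Unset Printing Implicit Defensive.

Import GRing.Theory.
Local Open Scope ring_scope.

(** * Irreducible factors of polynomials *)

Section IrreducibleFactors.

Variable F : fieldType.
Implicit Types (d f g h k p q r w y z : {poly F}).

Lemma eqp_irreducible p q : p %= q -> irreducible_poly p -> irreducible_poly q.
Proof.
move=> pq [sp irr_p]; split; first by rewrite -(eqp_size pq).
move=> d sd; rewrite -(eqp_dvdr _ pq) => /(irr_p _ sd) dp.
exact: eqp_trans dp pq.
Qed.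

(** Irreducibility over an arbitrary field is undecidable, so the existence of
    irreducible factors relies on excluded middle. *)
Lemma irreducible_factor p :
  size p != 1 -> p != 0 ->
  exists r, [/\ r \is monic, irreducible_poly r & r %| p].
Proof.
move=> sp p0.
suff [r [irr_r rp]] : exists r, irreducible_poly r /\ r %| p.
  have r0 := irredp_neq0 irr_r.
  have lr0 : (lead_coef r)^-1 != 0 by rewrite invr_eq0 lead_coef_eq0.
  have eqr := eqp_scale r lr0.
  exists ((lead_coef r)^-1 *: r); split.
  - by rewrite monicE lead_coefZ mulVf // lead_coef_eq0.
  - by apply: eqp_irreducible irr_r; rewrite eqp_sym.
  - by rewrite (eqp_dvdl _ eqr).
elim/ltn_ind: {p}(size p) {-2}p (erefl (size p)) sp p0 => n IH p pn sp p0.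
have s1 : (1 < size p)%N by rewrite ltn_neqAle eq_sym sp size_poly_gt0.
case: (classic (irreducible_poly p)) => [irr_p|nirr]; first by exists p.
have [q [sq qp nqp]] : exists q, [/\ size q != 1, q %| p & ~~ (q %= p)].
  apply: NNPP => nex; apply: nirr; split=> // q sq qp.
  by apply/negPn/negP => nqp; apply: nex; exists q.
have q0 : q != 0 by apply: contraNneq p0 => q0; rewrite q0 dvd0p in qp.
have sqn : (size q < n)%N.
  by rewrite -pn ltn_neqAle dvdp_leq // dvdp_size_eqp // nqp.
have [r [irr_r rq]] := IH _ sqn _ (erefl _) sq q0.
by exists r; split=> //; apply: dvdp_trans rq qp.
Qed.

Lemma ltn_size_irredpM p y : irreducible_poly p -> y != 0 ->
  (size y < size (p * y)%R)%N.
Proof.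
move=> ip y0; rewrite (size_mul (irredp_neq0 ip) y0).
by rewrite -subn1 ltn_subRL ltn_add2r ip.1.
Qed.

(** Induction along a factorization into monic irreducible polynomials. *)
Lemma irreducible_factor_ind (K : {poly F} -> Prop) :
  (forall c, c != 0 -> K c%:P) ->
  (forall p y, p \is monic -> irreducible_poly p -> y != 0 -> K y -> K (p * y)) ->
  forall y, y != 0 -> K y.
Proof.
move=> Kc Km y; elim/ltn_ind: {y}(size y) {-2}y (erefl (size y)) => n IH y yn y0.
have [sy|sy] := eqVneq (size y) 1.
  by move/eqP: sy => /size_poly1P [c c0 ->]; apply: Kc.
have [r [mr irr_r /dvdpP [k yE]]] := irreducible_factor sy y0.
have k0 : k != 0 by apply: contraNneq y0 => k0; rewrite yE k0 mul0r.
rewrite yE mulrC; apply: Km => //; apply: (IH (size k)) => //.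
by rewrite -yn yE mulrC ltn_size_irredpM.
Qed.

Lemma square_freeP h : h != 0 ->
  square_free h <->
  (forall p, p \is monic -> irreducible_poly p -> p %| h -> ~~ (p ^+ 2 %| h)).
Proof.
move=> h0; split=> [sf p _ irr_p _|sf q q2h].
  by apply/negP => /sf p1; have := irr_p.1; rewrite p1.
have qh : q %| h by apply: dvdp_trans q2h; rewrite expr2 dvdp_mulIl.
have q0 : q != 0 by apply: contraNneq h0 => q0; rewrite q0 dvd0p in qh.
apply/eqP/negPn/negP => sq.
have [p [mp irr_p pq]] := irreducible_factor sq q0.
move/negP: (sf p mp irr_p (dvdp_trans pq qh)); apply.
by apply: dvdp_trans q2h; rewrite !expr2 dvdp_mul.
Qed.

(** A square free polynomial divides every common multiple of its irreducible
    factors. *)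
Lemma square_free_dvdp h w : h != 0 -> square_free h ->
  (forall p, p \is monic -> irreducible_poly p -> p %| h -> p %| w) -> h %| w.
Proof.
move=> h0 sf hw.
suff : forall y, y != 0 -> y %| h -> y %| w by apply; rewrite ?dvdpp.
apply: irreducible_factor_ind => [c c0 _|p y mp irr_p y0 IH pyh].
  by rewrite -alg_polyC (eqp_dvdl _ (eqp_scale _ c0)) dvd1p.
have ph : p %| h by apply: dvdp_trans (dvdp_mulIl p y) pyh.
have yh : y %| h by apply: dvdp_trans (dvdp_mulIr p y) pyh.
suff cpy : coprimep p y by rewrite Gauss_dvdp // hw //= IH.
rewrite irreducible_poly_coprime //; apply/negP => py.
have /sf p1 : p ^+ 2 %| h.
  by apply: dvdp_trans pyh; rewrite expr2 dvdp_mul2l // irredp_neq0.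
by have := irr_p.1; rewrite p1.
Qed.

Lemma separable_square_free h : separable_poly h -> square_free h.
Proof.
case/separable_polyP => cop _ q; rewrite expr2 => /cop.
by rewrite coprimepp => /eqP.
Qed.

Lemma ex_roots h : h != 0 -> exists s : seq F, forall a, root h a = (a \in s).
Proof.
elim/ltn_ind: {h}(size h) {-2}h (erefl (size h)) => n IH h hn h0.
case: (classic (exists a, root h a)) => [[a ra]|nr]; last first.
  by exists [::] => a; rewrite in_nil; apply/negbTE/negP => ra; apply: nr; exists a.
have /factor_theorem [k hE] := ra.
have k0 : k != 0 by apply: contraNneq h0 => k0; rewrite hE k0 mul0r.
have sk : (size k < n)%N by rewrite -hn hE size_Mmonic ?monicXsubC // size_XsubC addn2.
have [s sE] := IH _ sk _ (erefl _) k0.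
by exists (a :: s) => b; rewrite hE rootM root_XsubC in_cons sE orbC.
Qed.

(** * Greatest common divisors *)

Lemma monic_gcd_eq p q f : f != 0 ->
  monic_gcd p f = monic_gcd q f <-> gcdp p f %= gcdp q f.
Proof.
move=> f0.
have l0 r : lead_coef (gcdp r f) != 0.
  by rewrite lead_coef_eq0 gcdp_eq0 (negPf f0) andbF.
have li r : (lead_coef (gcdp r f))^-1 != 0 by rewrite invr_eq0.
have mg r : monic_gcd r f \is monic by rewrite monicE lead_coefZ mulVf.
have eg r : monic_gcd r f %= gcdp r f by apply: eqp_scale.
split=> [e|e]; first by rewrite -(eqp_ltrans (eg p)) e.
apply/eqP; rewrite -eqp_monic ?mg // (eqp_ltrans (eg p)).
by rewrite (eqp_ltrans e) eqp_sym.
Qed.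

Lemma degree_monic_gcd p f : f != 0 ->
  degree (monic_gcd p f) = (size (gcdp p f)).-1.
Proof.
move=> f0; rewrite /degree size_scale // invr_eq0 lead_coef_eq0.
by rewrite gcdp_eq0 (negPf f0) andbF.
Qed.

Lemma dvdp_gcdM p q f : gcdp (p * q) f %| gcdp p f * gcdp q f.
Proof.
have [[a b] /= e1] := Bezoutp p f; have [[c d] /= e2] := Bezoutp q f.
rewrite -(eqp_dvdr _ (eqp_trans (eqp_mull _ e2) (eqp_mulr _ e1))).
have -> : (a * p + b * f) * (c * q + d * f) =
   (a * c) * (p * q) + (a * p * d + b * (c * q) + b * f * d) * f by ring.
by rewrite dvdp_add // dvdp_mull // ?dvdp_gcdl ?dvdp_gcdr.
Qed.

(** If [g] generates [F[X]/(d)] and [d | p o g], then the dimension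
    of [F[X]/(d)] is at most the degree of [p]. *)
Lemma leq_size_dvd_comp g d p : p != 0 -> d != 0 -> d %| p \Po g ->
  (forall w, exists z, d %| w - (z \Po g)) -> (size d <= size p)%N.
Proof.
move=> p0 d0 dpg gen.
pose m := (size p).-1; pose k := (size d).-1.
have mE : m.+1 = size p by rewrite prednK // size_poly_gt0.
have kE : k.+1 = size d by rewrite prednK // size_poly_gt0.
rewrite -mE -kE ltnS.
(* [M] is the matrix of the linear map sending a polynomial [s] of degree less
   than [deg p] to [s o g] modulo [d]; it is onto, hence has rank [deg d]. *)
pose M : 'M[F]_(m, k) := \matrix_(i < m) poly_rV ((g ^+ i) %% d).
suff fullM : (1%:M <= M)%MS.
  have := mxrankS fullM; rewrite mxrank1 => /leq_trans; apply.
  exact: rank_leq_row.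
apply/row_subP => j; rewrite row1.
have [z dz] := gen 'X^j.
have ss : (size (z %% p)%R <= m)%N by rewrite -ltnS mE ltn_modp.
have XE : 'X^j = ((z %% p) \Po g) %% d.
  have sX : (size ('X^j : {poly F}) < size d)%N by rewrite size_polyXn -kE ltnS.
  rewrite -[LHS](modp_small sX); apply/eqP; rewrite -subr_eq0 -modpN -modpD.
  rewrite -/(_ %| _).
  have -> : 'X^j - ((z %% p) \Po g) = ('X^j - (z \Po g)) + ((z %/ p) \Po g) * (p \Po g).
    rewrite {2}(divp_eq z p) comp_polyD comp_polyM opprD addrA addrAC.
    by rewrite subrK.
  by rewrite dvdp_add // dvdp_mull.
have modE : ((z %% p) \Po g) %% d = \sum_(i < m) (z %% p)`_i *: (g ^+ i %% d).
  rewrite comp_polyE (big_ord_widen _ (fun i => (z %% p)`_i *: g ^+ i) ss).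
  rewrite big_mkcond (big_morph _ (modpD d) (mod0p d)); apply: eq_bigr => i _.
  by case: ltnP => [_|si]; rewrite ?modpZl // nth_default // scale0r mod0p.
apply/submxP; exists (poly_rV (z %% p)); apply/rowP => i; rewrite !mxE /=.
under eq_bigr => l _ do rewrite !mxE -coefZ.
by rewrite -coef_sum -modE -XE coefXn.
Qed.

End IrreducibleFactors.

(** * The substitution of [g] as a map from F[X]/(h) to F[X]/(f) *)

Section Substitution.

Variables (F : fieldType) (f g h : {poly F}).
Hypotheses (f0 : f != 0) (h0 : h != 0).
Hypothesis fhE : forall y, (f %| y \Po g) = (h %| y).
Implicit Types (p q r y : {poly F}).

Lemma minpolys_modP p :
  minpolys_mod g f p <-> [/\ p \is monic, irreducible_poly p & p %| h].
Proof.
split=> [[r [mr irr_r rf [mp pE]]]|[mp irr_p ph]].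
  have ph : p %| h by rewrite -pE; apply: dvdp_trans rf _; rewrite fhE.
  split=> //; split=> [|q sq qp].
    rewrite ltn_neqAle eq_sym size_poly_gt0 monic_neq0 // andbT.
    apply/negP => sp; have : p %| 1 by rewrite dvdp1.
    by rewrite -pE comp_polyC dvdp1 => /eqP sr; have := irr_r.1; rewrite sr.
  have [k kE] := dvdpP _ _ qp.
  have q0 : q != 0.
    by apply: contraTneq mp => q0; rewrite kE q0 mulr0 monicE lead_coef0 eq_sym oner_eq0.
  have k0 : k != 0.
    by apply: contraTneq mp => k0; rewrite kE k0 mul0r monicE lead_coef0 eq_sym oner_eq0.
  rewrite /eqp qp /= -pE.
  (* [p] is [k * q] and [r] is prime, so [r] divides [q o g], as wanted, or
     [k o g]; the latter would give [p | k], against the degree of [q]. *)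
  have : r %| (k \Po g) * (q \Po g) by rewrite -comp_polyM -kE pE.
  have [//|nrq] := boolP (r %| q \Po g).
  rewrite Gauss_dvdpl ?irreducible_poly_coprime // pE => pk.
  case/negP: sq; have := dvdp_leq k0 pk.
  rewrite kE size_mul // => le_s; rewrite eqn_leq size_poly_gt0 q0 andbT.
  move: le_s; rewrite -subn1 leq_subLR addnC [(1 + _)%N]addnC => le_s.
  by move: le_s; rewrite addnC leq_add2l.
(* If [p o g] were prime to [f], then [h / p] would kill [g] modulo [f]. *)
have [k hE] := dvdpP _ _ ph.
have k0 : k != 0 by apply: contraNneq h0 => k0; rewrite hE k0 mul0r.
have p0 := irredp_neq0 irr_p.
have ncop : size (gcdp (p \Po g) f) != 1.
  apply/negP => cop; have cop' : coprimep f (p \Po g) by rewrite coprimep_sym.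
  have : f %| (k \Po g) * (p \Po g).
    by rewrite -comp_polyM -hE fhE.
  rewrite (Gauss_dvdpl _ cop') fhE => /(dvdp_leq k0).
  by rewrite leqNgt hE mulrC ltn_size_irredpM.
have g0 : gcdp (p \Po g) f != 0 by rewrite gcdp_eq0 (negPf f0) andbF.
have [r [mr irr_r]] := irreducible_factor ncop g0.
rewrite dvdp_gcd => /andP [rp rf]; exists r; split=> //.
have [q [mq qE]] := is_minpoly_mod_exists g mr irr_r.
suff -> : p = q by [].
apply/eqP; rewrite -eqp_monic // eqp_sym; apply: irr_p.2; last by rewrite -qE.
apply/negP => sq; have : q %| 1 by rewrite dvdp1.
by rewrite -qE comp_polyC dvdp1 => /eqP sr; have := irr_r.1; rewrite sr.
Qed.

Lemma gcd_compP p : p \is monic -> irreducible_poly p -> p %| h ->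
  gcdp (p \Po g) f %= gcdp ((p \Po g) ^+ 2) f <-> ~~ (p ^+ 2 %| h).
Proof.
move=> mp irr_p ph; have p0 := irredp_neq0 irr_p.
have [k hE] := dvdpP _ _ ph.
have k0 : k != 0 by apply: contraNneq h0 => k0; rewrite hE k0 mul0r.
split=> [e|np2].
  (* With [h = p * p * l] and [d := gcd((p o g)^2, f)] dividing [p o g], Bezout
     shows that [f] divides [d * (l o g)], hence that [h] divides [p * l]. *)
  apply/negP => /dvdpP [l lE].
  have l0 : l != 0 by apply: contraNneq h0 => l0; rewrite lE l0 mul0r.
  have [[u v] /= uv] := Bezoutp ((p \Po g) ^+ 2) f.
  have dp : u * (p \Po g) ^+ 2 + v * f %| p \Po g.
    by rewrite (eqp_dvdl _ uv) -(eqp_dvdl _ e) dvdp_gcdl.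
  have : f %| (p \Po g) * (l \Po g).
    apply: dvdp_trans (dvdp_mul dp (dvdpp (l \Po g))).
    rewrite mulrDl dvdp_add //; last by rewrite dvdp_mulr // dvdp_mull.
    rewrite -mulrA mulrC dvdp_mulr // mulrC expr2.
    by rewrite -!comp_polyM fhE -expr2 -lE.
  rewrite -comp_polyM fhE => /(dvdp_leq (mulf_neq0 p0 l0)).
  have -> : h = p * (p * l) by rewrite lE mulrC expr2 mulrA.
  by rewrite leqNgt ltn_size_irredpM // mulf_neq0.
have cpk : coprimep p k.
  rewrite irreducible_poly_coprime //; apply: contra np2 => pk.
  by rewrite hE expr2 dvdp_mul.
have [[u v] /= uv] := Bezout_eq1_coprimepP _ _ cpk.
rewrite /eqp !dvdp_gcd !dvdp_gcdr !andbT expr2 dvdp_mulr ?dvdp_gcdl //=.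
have pgE : p \Po g = (u \Po g) * ((p \Po g) * (p \Po g)) + (v \Po g) * (h \Po g).
  rewrite -!comp_polyM -comp_polyD; congr (_ \Po g).
  by rewrite -[LHS]mulr1 -uv hE; ring.
have fh : f %| h \Po g by rewrite fhE.
rewrite [X in _ %| X]pgE dvdp_add // dvdp_mull ?dvdp_gcdl //.
exact: dvdp_trans (dvdp_gcdr _ _) fh.
Qed.

Lemma square_free_gcd_comp :
  square_free h <->
  (forall p, minpolys_mod g f p ->
     monic_gcd (p \Po g) f = monic_gcd ((p \Po g) ^+ 2) f).
Proof.
rewrite square_freeP //; split=> H p => [/minpolys_modP [mp ip ph]|mp ip ph].
  by apply/monic_gcd_eq => //; apply/gcd_compP => //; apply: H.
by apply/gcd_compP => //; apply/monic_gcd_eq => //; apply/H/minpolys_modP.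
Qed.

(** Bounding the degree of [gcd(p o g, f)] on the irreducible factors of [h]
    bounds it on all factors of [h]; the case of [h] itself bounds [f]. *)
Lemma leq_size_gcd_comp :
  (forall p, minpolys_mod g f p -> (size (gcdp (p \Po g) f) <= size p)%N) ->
  (size f <= size h)%N.
Proof.
move=> P_le; have d0 y : gcdp (y \Po g) f != 0.
  by rewrite gcdp_eq0 (negPf f0) andbF.
suff H y : y != 0 -> y %| h -> (size (gcdp (y \Po g) f) <= size y)%N.
  apply: leq_trans (H h h0 (dvdpp h)); apply: dvdp_leq (d0 h) _.
  by rewrite dvdp_gcd dvdpp fhE dvdpp.
elim/irreducible_factor_ind: y / => [c c0 _|p y mp irr_p y0 IH pyh].
  rewrite comp_polyC size_polyC c0.
  have : gcdp c%:P f %| c%:P by apply: dvdp_gcdl.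
  by move/dvdp_leq; rewrite polyC_eq0 size_polyC c0; apply.
have ph : p %| h by apply: dvdp_trans (dvdp_mulIl p y) pyh.
have yh : y %| h by apply: dvdp_trans (dvdp_mulIr p y) pyh.
have p_le : (size (gcdp (p \Po g) f) <= size p)%N.
  by apply: P_le; apply/minpolys_modP.
rewrite comp_polyM.
apply: leq_trans (dvdp_leq (mulf_neq0 (d0 p) (d0 y)) (dvdp_gcdM _ _ _)) _.
rewrite !size_mul ?(irredp_neq0 irr_p) ?d0 // -!subn1 leq_sub2r // leq_add //.
exact: IH.
Qed.

Lemma size_gcd_comp p :
  (forall w, exists z, f %| w - (z \Po g)) -> size f = size h -> p %| h ->
  size (gcdp (p \Po g) f) = size p.
Proof.
move=> gen sfh /dvdpP [k hE].
have k0 : k != 0 by apply: contraNneq h0 => k0; rewrite hE k0 mul0r.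
have p0 : p != 0 by apply: contraNneq h0 => p0; rewrite hE p0 mulr0.
have d0 y : gcdp (y \Po g) f != 0 by rewrite gcdp_eq0 (negPf f0) andbF.
have d_le y : y != 0 -> (size (gcdp (y \Po g) f) <= size y)%N.
  move=> y0; apply: (@leq_size_dvd_comp _ g) => //; first exact: dvdp_gcdl.
  move=> w; have [z fz] := gen w; exists z.
  exact: dvdp_trans (dvdp_gcdr _ _) fz.
apply/eqP; rewrite eqn_leq d_le //=.
have f_dv : f %| gcdp (k \Po g) f * gcdp (p \Po g) f.
  apply: dvdp_trans (dvdp_gcdM _ _ _).
  by rewrite dvdp_gcd dvdpp andbT -comp_polyM -hE fhE.
have := dvdp_leq (mulf_neq0 (d0 k) (d0 p)) f_dv.
rewrite sfh hE !size_mul // -!subn1 leq_subLR subnKC; last first.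
  by rewrite addn_gt0 size_poly_gt0 d0.
move=> le1; rewrite -(leq_add2l (size k)); apply: leq_trans le1 _.
by rewrite leq_add2r d_le.
Qed.

(** If all the irreducible factors of [h] are linear, then every root of [h] in
    an extension field comes from the base field. *)
Lemma root_map_split (s : seq F) (L : fieldType) (iota : {rmorphism F -> L}) a :
  (forall p, p \is monic -> irreducible_poly p -> p %| h ->
     p \in [seq 'X - b%:P | b <- s]) ->
  root (map_poly iota h) a -> exists b, a = iota b.
Proof.
move=> lin; suff H y : y != 0 -> y %| h -> root (map_poly iota y) a ->
  exists b, a = iota b by apply: H h0 (dvdpp h).
elim/irreducible_factor_ind: y / => [c c0 _|p y mp irr_p y0 IH pyh].
  by rewrite map_polyC rootC fmorph_eq0 (negPf c0).
have ph : p %| h by apply: dvdp_trans (dvdp_mulIl p y) pyh.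
have yh : y %| h by apply: dvdp_trans (dvdp_mulIr p y) pyh.
have /mapP [b _ ->] := lin p mp irr_p ph.
rewrite rmorphM rootM /= => /orP []; last exact: IH.
by rewrite map_polyXsubC root_XsubC => /eqP ->; exists b.
Qed.

End Substitution.

(** * Matrices *)

Section Matrices.

Variables (F : fieldType) (n : nat).
Implicit Types (A B : 'M[F]_n.+1) (g y : {poly F}).

Lemma horner_mx_comp A g y :
  horner_mx (horner_mx A g) y = horner_mx A (y \Po g).
Proof.
elim/poly_ind: y => [|y c IHy]; first by rewrite comp_poly0 !rmorph0.
by rewrite comp_polyD comp_polyM comp_polyX comp_polyC !rmorphD !rmorphM /=
  IHy !horner_mx_C horner_mx_X.
Qed.

Lemma dvd_mxminpoly_comp A g y :
  (mxminpoly A %| y \Po g) = (mxminpoly (horner_mx A g) %| y).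
Proof. by rewrite !dvd_mxminpoly horner_mx_comp. Qed.

Lemma is_cyclic_mxE A : is_cyclic_mx A <-> degree_mxminpoly A = n.+1.
Proof.
rewrite /is_cyclic_mx; split=> [e|e].
  by apply: succn_inj; rewrite -size_mxminpoly e size_char_poly.
apply/eqP; rewrite -eqp_monic ?mxminpoly_monic ?char_poly_monic //.
by rewrite -dvdp_size_eqp ?mxminpoly_dvd_char // size_mxminpoly size_char_poly e.
Qed.

Lemma degree_mxminpoly_le A : (degree_mxminpoly A <= n.+1)%N.
Proof.
rewrite -ltnS -size_mxminpoly -(size_char_poly A) dvdp_leq ?mxminpoly_dvd_char //.
by rewrite monic_neq0 // char_poly_monic.
Qed.

(** The algebra generated by [g(A)] is contained in that generated by [A]. *)
Lemma powers_mx_horner A g :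
  (powers_mx (horner_mx A g) (degree_mxminpoly (horner_mx A g))
     <= powers_mx A (degree_mxminpoly A))%MS.
Proof.
by apply/row_subP => i; rewrite rowK -rmorphXn horner_mx_mem.
Qed.

Lemma degree_mxminpoly_horner A g :
  (degree_mxminpoly (horner_mx A g) <= degree_mxminpoly A)%N.
Proof.
have := mxrankS (powers_mx_horner A g).
by rewrite !(eqP (minpoly_mx_free _)).
Qed.

(** If [A] and [g(A)] have minimal polynomials of the same degree, then
    [A] is a polynomial in [g(A)]; in other words [g] generates the algebra
    [F[X]/(mxminpoly A)]. *)
Lemma horner_mx_generates A g :
  degree_mxminpoly (horner_mx A g) = degree_mxminpoly A ->
  forall w, exists z, mxminpoly A %| w - (z \Po g).
Proof.
move=> e w; have := mxrank_leqif_eq (powers_mx_horner A g).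
rewrite /= !(eqP (minpoly_mx_free _)) => -[_ eqAB].
have /andP [_ AB] := etrans (esym eqAB) (introT eqP e).
have := submx_trans (horner_mx_mem A w) AB => /mx_inv_hornerK wE.
exists (mx_inv_horner (horner_mx A g) (horner_mx A w)).
by rewrite dvd_mxminpoly rmorphB /= -horner_mx_comp wE subrr.
Qed.

End Matrices.

Theorem theorem7p1 (F : fieldType) (n : nat) (g f : {poly F})
    (A : 'M[F]_n.+1) (hf : f = mxminpoly A) :
  [/\
    (* (1) *)
    semisimple (horner_mx A g) <->
      (forall p : {poly F}, minpolys_mod g f p ->
        monic_gcd (p \Po g) f = monic_gcd ((p \Po g) ^+ 2) f),
    (* (2) *)
    is_cyclic_mx (horner_mx A g) <->
      (is_cyclic_mx A /\
       forall p : {poly F}, minpolys_mod g f p ->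
         degree (monic_gcd (p \Po g) f) = degree p)
  & (* (3) *)
    (all_eigenvalues_in_base (horner_mx A g) <->
      exists s : seq F, forall p : {poly F},
        minpolys_mod g f p <-> p \in [seq 'X - a%:P | a <- s])
    /\
    (forall s : seq F,
      (forall p : {poly F},
        minpolys_mod g f p <-> p \in [seq 'X - a%:P | a <- s]) ->
      (forall a : F, eigenvalue (horner_mx A g) a <-> a \in s) /\
      (diagonalizable (horner_mx A g) <->
        (forall a : F, a \in s ->
          monic_gcd (g - a%:P) f = monic_gcd ((g - a%:P) ^+ 2) f)))].
Proof.
set B := horner_mx A g; pose h := mxminpoly B.
have f0 : f != 0 by rewrite hf monic_neq0 ?mxminpoly_monic.
have h0 : h != 0 by rewrite monic_neq0 ?mxminpoly_monic.
have fhE y : (f %| y \Po g) = (h %| y) by rewrite hf dvd_mxminpoly_comp.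
have PP := minpolys_modP f0 h0 fhE.
have d0 y : gcdp (y \Po g) f != 0 by rewrite gcdp_eq0 (negPf f0) andbF.
have sf : size f = (degree_mxminpoly A).+1 by rewrite hf size_mxminpoly.
have sh : size h = (degree_mxminpoly B).+1 by rewrite size_mxminpoly.
have semiE := square_free_gcd_comp f0 h0 fhE.
split=> //.
- split=> [cB|[cA P_deg]].
    have eB := (is_cyclic_mxE B).1 cB.
    have eA : degree_mxminpoly A = n.+1.
      apply/eqP; rewrite eqn_leq degree_mxminpoly_le -eB.
      exact: degree_mxminpoly_horner.
    split=> [|p /PP [mp ip ph]]; first exact/is_cyclic_mxE.
    rewrite degree_monic_gcd // /degree; congr _.-1.
    apply: (size_gcd_comp f0 h0 fhE) => //; last by rewrite sf sh eA eB.
    by rewrite hf; apply: horner_mx_generates; rewrite eA.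
  have eA := (is_cyclic_mxE A).1 cA.
  apply/is_cyclic_mxE/eqP; rewrite eqn_leq degree_mxminpoly_le /= -eA.
  rewrite -ltnS -sf -sh; apply: (leq_size_gcd_comp f0 h0 fhE) => p Pp.
  have [mp ip _] := (PP p).1 Pp.
  have := P_deg p Pp; rewrite degree_monic_gcd // /degree => e.
  by rewrite -(prednK (n := size p)) -?e ?prednK ?size_poly_gt0 ?(irredp_neq0 ip) ?d0.
- split.
    split=> [allF|[s sP] L iota a].
      (* An irreducible factor of [h] has a root in some extension field; this
         root is an eigenvalue, so lies in [F], and the factor is linear. *)
      have [s sE] := ex_roots h0; exists s => p; rewrite PP; split.
        move=> [mp ip ph]; have [L _ [z rz _]] := irredp_FAdjoin ip.
        have : eigenvalue (map_mx (GRing.in_alg L) B) z.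
          rewrite eigenvalue_root_min mxminpoly_map -/h.
          by have /dvdpP [k ->] := ph; rewrite rmorphM rootM /= rz orbT.
        move=> /allF [b zE]; have rb : root p b.
          by move: rz; rewrite zE fmorph_root.
        have bs : b \in s by rewrite -sE; apply: root_dvdp rb.
        apply/mapP; exists b => //; apply/eqP.
        rewrite -eqp_monic ?monicXsubC // eqp_sym; apply: ip.2.
          by rewrite size_XsubC.
        by rewrite dvdp_XsubCl.
      move=> /mapP [a sa ->]; split; rewrite ?monicXsubC ?dvdp_XsubCl ?sE //.
      exact: irredp_XsubC.
    rewrite eigenvalue_root_min mxminpoly_map -/h.
    by apply: (root_map_split h0) => p mp ip ph; apply/sP/PP.
  move=> s sP; have eigE a : eigenvalue B a <-> a \in s.
    rewrite eigenvalue_root_min -dvdp_XsubCl.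
    have -> : a \in s = ('X - a%:P \in [seq 'X - b%:P | b <- s]).
      rewrite (mem_map (f := fun b : F => 'X - b%:P)) // => x y /addrI /oppr_inj.
      exact: polyC_inj.
    rewrite -sP PP; split=> [ah|[]//]; split=> //; first exact: monicXsubC.
    exact: irredp_XsubC.
  split=> //.
  have gE a : g - a%:P = ('X - a%:P) \Po g.
    by rewrite comp_polyB comp_polyX comp_polyC.
  have gcdE : (forall a, a \in s ->
      monic_gcd (g - a%:P) f = monic_gcd ((g - a%:P) ^+ 2) f) <-> square_free h.
    rewrite semiE; split=> H => [p /sP /mapP [a sa ->]|a sa].
      by rewrite -gE H.
    by rewrite gE; apply/H/sP/map_f.
  rewrite gcdE; split.
    move=> /diagonalizableP [rs urs hrs]; apply: separable_square_free.
    by apply: dvdp_separable hrs _; rewrite separable_prod_XsubC.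
  move=> sfh; apply/diagonalizableP; exists (undup s); first exact: undup_uniq.
  apply: square_free_dvdp => // p mp ip ph.
  have /mapP [a sa ->] : p \in [seq 'X - a%:P | a <- s] by apply/sP/PP.
  by rewrite dvdp_XsubCl root_prod_XsubC mem_undup.
Qed.
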